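(* Let $p$ be a prime, and let $h_1,h_2$ be two elements of $H_1(F_r,\mathbf{Z}/p\mathbf{Z})=(\mathbf{Z}/p\mathbf{Z})^r$. Let $W_{r,n,h_1}$ and $W_{r,n,h_2}$ be the numbers of cyclically reduced words of length $n$ in $F_r$ homologous to $h_1$ and $h_2$, respectively. Then $$\lim_{n\to\infty}\frac{W_{r,n,h_2}}{W_{r,n,h_1}}=1.$$
   Context: $F_r=\langle a_1,\dots,a_r\rangle$ is the free group of rank $r$. A word in the letters $a_1^{\pm1},\dots,a_r^{\pm1}$ is cyclically reduced if no letter is adjacent to its inverse, where the last and first letters of the word are also regarded as adjacent. A word is homologous to $h\in H_1(F_r,\mathbf{Z}/p\mathbf{Z})=(\mathbf{Z}/p\mathbf{Z})^r$ if its vector of total exponents $(e_1,\dots,e_r)$ of the generators, reduced mod $p$, equals $h$.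
   Formalization: The formal theorem assumes p is odd and r ≥ 2; for p = 2 (by parity of the exponent sum) and for r ≤ 1, the number W_{r,n,h_1} is zero for infinitely many n, so the ratio is undefined there and the limit does not exist. *)

(* Defs.v *)
From HB Require Import structures.
From mathcomp Require Import all_boot all_order all_algebra.
Set Implicit Arguments.
Unset Strict Implicit.
Unset Printing Implicit Defensive.
Import GRing.Theory.
Local Open Scope ring_scope.

(* [(i, false)] stands for a_i and [(i, true)] for a_i^{-1}. *)
Definition letter (r : nat) : finType := ('I_r * bool)%type.

Definition inv_letter (r : nat) (x : letter r) : letter r := (x.1, ~~ x.2).

(* [cycle] also compares the last letter with the first one. *)
Definition cyclically_reduced (r : nat) (w : seq (letter r)) : bool :=
  cycle (fun x y => y != inv_letter x) w.

Definition total_exponent (r : nat) (w : seq (letter r)) (i : 'I_r) : int :=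
  \sum_(x <- w | x.1 == i) (-1) ^+ x.2.

(* For [prime p], ['F_p] is Z/pZ, so ['rV['F_p]_r] is H_1(F_r, Z/pZ). *)
Definition homology_class (p r : nat) (w : seq (letter r)) : 'rV['F_p]_r :=
  \row_i (total_exponent w i)%:~R.

Definition W (p r n : nat) (h : 'rV['F_p]_r) : nat :=
  #|[set w : n.-tuple (letter r) |
      cyclically_reduced w & homology_class p w == h]|.

(* Main.v *)
(* Regard a reduced word as a walk on the states (last letter, homology class).
   This walk is (2r-1)-regular in both directions, and cyclically reduced words
   homologous to h are the walks from (x, 0) to (x, h). Every state carries loops
   of the coprime lengths p and p + 2, and any state leads to any other, so some
   power of the transition matrix is positive. By Doeblin's contraction the walk
   equidistributes, hence W n h / (2r-1)^n has a positive limit independent of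
   h. *)
Require Import Defs.
From mathcomp Require Import all_boot all_order all_algebra.
From mathcomp Require Import all_classical all_reals all_analysis.
From mathcomp Require Import zify.
Import numFieldNormedType.Exports.
Import Order.TTheory GRing.Theory Num.Theory.
Local Open Scope classical_set_scope.
Local Open Scope ring_scope.
Set Implicit Arguments.
Unset Strict Implicit.
Unset Printing Implicit Defensive.

(** * Equidistribution of walks on a finite regular digraph *)

Section RegularWalks.
Variables (S : finType) (e : rel S).

Fixpoint nwalks (n : nat) (s t : S) : nat :=
  if n is n'.+1 then \sum_(u | e s u) nwalks n' u t else s == t.

Lemma nwalksD m n s t :
  nwalks (m + n) s t = (\sum_u nwalks m s u * nwalks n u t)%N.
Proof.
elim: m s => [|m IH] s /=.
  by rewrite add0n (bigD1 s) //= eqxx mul1n big1 ?addn0 // => u /negPf;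
     rewrite eq_sym => ->.
under eq_bigr do rewrite IH.
by rewrite exchange_big; apply: eq_bigr => u _; rewrite big_distrl.
Qed.

(** Finiteness of [S] makes the thresholds uniform: one length beyond their maximum serves every
    pair. *)
Lemma primitive_of_long_walks :
  (forall s t, exists N, forall n, (N <= n)%N -> (0 < nwalks n s t)%N) ->
  exists2 m, (0 < m)%N & forall s t, (0 < nwalks m s t)%N.
Proof.
move=> H.
have [N HN] := choice (fun u : S * S => H u.1 u.2).
exists (\max_u N u).+1 => // s t; apply: (HN (s, t)).
by apply: leqW; apply: (leq_bigmax (s, t)).
Qed.

Variables (d : nat).
Hypothesis out_regular : forall s, #|e s| = d.
Hypothesis in_regular : forall t, #|e^~ t| = d.

Lemma sum_nwalks_out n s : (\sum_t nwalks n s t = d ^ n)%N.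
Proof.
elim: n s => [|n IH] s /=.
  by rewrite (bigD1 s) //= eqxx big1 // => t /negPf; rewrite eq_sym => ->.
rewrite exchange_big /=; under eq_bigr do rewrite IH.
by rewrite sum_nat_const expnS -(out_regular s).
Qed.

(** Together with the row sums this makes the normalised transition matrix doubly stochastic, which
    is why the limit distribution is uniform. *)
Lemma sum_nwalks_in n t : (\sum_s nwalks n s t = d ^ n)%N.
Proof.
elim: n => [|n IH] /=.
  by rewrite (bigD1 t) //= eqxx big1 // => s /negPf ->.
under eq_bigr do rewrite big_mkcond.
rewrite exchange_big /= expnS -IH big_distrr; apply: eq_bigr => u _ /=.
by rewrite -big_mkcond sum_nat_const -(in_regular u).
Qed.

Variable R : realType.
Hypothesis d_gt0 : (0 < d)%N.

Let s : R := #|S|%:R.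
Let dev n u t : R := (nwalks n u t)%:R / d%:R ^+ n - s^-1.

Let d_neq0 n : d%:R ^+ n != 0 :> R.
Proof. by rewrite expf_neq0 // pnatr_eq0 -lt0n. Qed.

Let s_gt0 (u : S) : 0 < s.
Proof. by rewrite ltr0n; apply/card_gt0P; exists u. Qed.

Let sum_dev n t : \sum_u dev n u t = 0.
Proof.
rewrite sumrB -mulr_suml -natr_sum sum_nwalks_in natrX divff //.
by rewrite sumr_const -[X in _ - X]mulr_natr mulVf ?subrr // gt_eqF ?(s_gt0 t).
Qed.

Let devD m n u t :
  dev (m + n) u t = \sum_v (nwalks m u v)%:R / d%:R ^+ m * dev n v t.
Proof.
transitivity (\sum_v ((nwalks m u v)%:R / d%:R ^+ m *
                      ((nwalks n v t)%:R / d%:R ^+ n)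
                    - (nwalks m u v)%:R / d%:R ^+ m * s^-1)); last first.
  by apply: eq_bigr => v _; rewrite mulrBr.
rewrite sumrB -!mulr_suml -natr_sum sum_nwalks_out natrX divff // mul1r.
congr (_ - _); rewrite nwalksD natr_sum mulr_suml; apply: eq_bigr => v _.
by rewrite natrM exprD invfM mulrACA.
Qed.

Variable m : nat.
Hypotheses (m_gt0 : (0 < m)%N) (m_prim : forall u v, (0 < nwalks m u v)%N).

(** The mass left in each row of the [m]-step transition matrix once [d^-m] is taken from every
    entry; it is the contraction factor. *)
Let q : R := 1 - s / d%:R ^+ m.

Let q_lt1 (u : S) : q < 1.
Proof. by rewrite /q ltrBlDr ltrDl divr_gt0 ?s_gt0 // exprn_gt0 ?ltr0n. Qed.

Let sum_excess u : \sum_v ((nwalks m u v)%:R - 1) / d%:R ^+ m = q.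
Proof.
rewrite -mulr_suml sumrB -natr_sum sum_nwalks_out natrX mulrBl divff //.
by rewrite sumr_const.
Qed.

Let excess_ge0 u v : 0 <= ((nwalks m u v)%:R - 1) / d%:R ^+ m :> R.
Proof. by rewrite divr_ge0 ?exprn_ge0 ?ler0n // subr_ge0 ler1n. Qed.

Let q_ge0 (u : S) : 0 <= q.
Proof. by rewrite -(sum_excess u) sumr_ge0. Qed.

(* Since the deviations sum to zero, the transition matrix may be decreased by
   a constant before it is applied to them: this is Doeblin's contraction. *)
Let dev_contract n t (B : R) :
  (forall v, `|dev n v t| <= B) -> forall u, `|dev (m + n) u t| <= q * B.
Proof.
move=> HB u.
have -> : dev (m + n) u t =
    \sum_v ((nwalks m u v)%:R - 1) / d%:R ^+ m * dev n v t.
  (* The two sums differ by [d^-m] times the total deviation, which is zero. *)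
  rewrite devD; apply/eqP; rewrite -subr_eq0 -sumrB.
  under eq_bigr do rewrite -mulrBl -mulrBl opprB addrC subrK.
  by rewrite -mulr_sumr sum_dev mulr0.
apply: le_trans (ler_norm_sum _ _ _) _; rewrite -(sum_excess u) mulr_suml.
apply: ler_sum => v _; rewrite normrM ger0_norm //.
exact: ler_wpM2l.
Qed.

Let dev_le1 n u t : `|dev n u t| <= 1.
Proof.
have a0 : 0 <= (nwalks n u t)%:R / d%:R ^+ n :> R.
  by rewrite divr_ge0 ?exprn_ge0.
have a1 : (nwalks n u t)%:R / d%:R ^+ n <= 1 :> R.
  rewrite ler_pdivrMr ?exprn_gt0 ?ltr0n // mul1r -natrX ler_nat.
  by rewrite -(sum_nwalks_out n u) (bigD1 t) //= leq_addr.
have b0 : 0 <= s^-1 by rewrite invr_ge0 ltW ?(s_gt0 u).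
have b1 : s^-1 <= 1.
  by rewrite invf_le1 ?(s_gt0 u) // ler1n -(ltr0n R) (s_gt0 u).
rewrite ler_norml /dev lerBrDr addrC; apply/andP; split.
  by apply: le_trans a0; rewrite subr_le0.
by apply: le_trans (_ : (nwalks n u t)%:R / d%:R ^+ n <= _); rewrite ?gerBl.
Qed.

(** Each full block of [m] steps contributes a factor [q]; for the remaining [n %% m] steps the
    trivial bound 1 is enough. *)
Let dev_geometric n u t : `|dev n u t| <= q ^+ (n %/ m).
Proof.
rewrite {1}(divn_eq n m); elim: (n %/ m)%N u => [|k IH] u.
  by rewrite mul0n add0n expr0.
by rewrite mulSn -addnA exprS; apply: dev_contract.
Qed.

Lemma nwalks_equidistribution u t :
  (nwalks n u t)%:R / d%:R ^+ n @[n --> \oo] --> (#|S|%:R^-1 : R).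
Proof.
have div_oo : (n %/ m)%N @[n --> \oo] --> \oo.
  apply/cvgnyPge => A; near=> n.
  by rewrite leq_divRL //; near: n; apply: nbhs_infty_ge.
have q0 : q ^+ (n %/ m)%N @[n --> \oo] --> (0 : R).
  apply: (@cvg_comp _ _ _ (fun n => (n %/ m)%N) (GRing.exp q) _ _ _ div_oo).
  by apply: cvg_expr; rewrite ger0_norm ?(q_ge0 u) ?(q_lt1 u).
have nq0 : - q ^+ (n %/ m)%N @[n --> \oo] --> (0 : R).
  by rewrite -[X in _ --> X]oppr0; apply: cvgN.
have dev0 : dev n u t @[n --> \oo] --> (0 : R).
  apply: squeeze_cvgr nq0 q0; near=> n.
  by rewrite -ler_norml.
have -> : (fun n => (nwalks n u t)%:R / d%:R ^+ n) = (fun n => dev n u t + s^-1).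
  by apply/funext => n; rewrite subrK.
by rewrite -[X in _ --> X]add0r; apply: cvgD dev0 _; apply: cvg_cst.
Unshelve. all: by end_near.
Qed.

End RegularWalks.

Lemma card_tuple_cons (T : finType) n (P : pred (n.+1.-tuple T)) :
  #|P| = (\sum_(x : T) #|[pred w : n.-tuple T | P (cons_tuple x w)]|)%N.
Proof.
rewrite -sum1_card; under [RHS]eq_bigr do rewrite -sum1_card.
rewrite pair_big_dep /=.
rewrite (reindex (fun u : T * n.-tuple T => cons_tuple u.1 u.2)) //=.
exists (fun w => (thead w, behead_tuple w)) => [[x w] _|w _] /=.
  by congr pair; apply: val_inj.
by rewrite [RHS]tuple_eta.
Qed.

(** * Letters, homology classes mod p, and the walk on states *)

Section LetterHomology.
Variables p r : nat.

Definition adjacent (x y : letter r) : bool := y != inv_letter x.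

Definition letter_class (x : letter r) : 'rV['F_p]_r := homology_class p [:: x].

Lemma inv_letterK : involutive (@inv_letter r).
Proof. by case=> i b; rewrite /inv_letter /= negbK. Qed.

Lemma adjacentC x y : adjacent x y = adjacent y x.
Proof. by rewrite /adjacent -(inj_eq (can_inj inv_letterK)) inv_letterK eq_sym. Qed.

Lemma adjacent_neq_index x y : x.1 != y.1 -> adjacent x y.
Proof. by apply: contra_neq => ->. Qed.

Lemma adjacent_refl x : adjacent x x.
Proof. by case: x => i []; rewrite /adjacent /inv_letter xpair_eqE /= andbF. Qed.

Lemma path_adjacent_nseq n x : path adjacent x (nseq n x).
Proof. by elim: n => //= n ->; rewrite adjacent_refl. Qed.

Lemma last_nseq n (x : letter r) : last x (nseq n x) = x.
Proof. by elim: n. Qed.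

Lemma homology_class_cat (v w : seq (letter r)) :
  homology_class p (v ++ w) = homology_class p v + homology_class p w.
Proof. by apply/rowP => i; rewrite !mxE /total_exponent big_cat rmorphD. Qed.

Lemma homology_class_cons x (w : seq (letter r)) :
  homology_class p (x :: w) = letter_class x + homology_class p w.
Proof. by rewrite -cat1s homology_class_cat. Qed.

Lemma homology_class_nil : homology_class p ([::] : seq (letter r)) = 0.
Proof. by apply/rowP => i; rewrite !mxE /total_exponent big_nil. Qed.

Lemma homology_class_nseq n x : homology_class p (nseq n x) = letter_class x *+ n.
Proof.
elim: n => [|n IH]; first exact: homology_class_nil.
by rewrite /= homology_class_cons IH mulrS.
Qed.

Lemma letter_classE x i :
  letter_class x 0 i = if x.1 == i then (-1) ^+ x.2 else 0.
Proof.
rewrite mxE /total_exponent big_cons big_nil; case: eqP => // _.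
by rewrite addr0 rmorphXn rmorphN rmorph1.
Qed.

Lemma letter_class_inv x : letter_class (inv_letter x) = - letter_class x.
Proof.
apply/rowP => i; rewrite [RHS]mxE !letter_classE /=; case: eqP; rewrite ?oppr0 // => _.
by case: x.2; rewrite /= ?expr0 ?expr1 ?opprK.
Qed.

(** Coordinates in ['F_p] act through their natural representatives, so sums of generators suffice,
    without inverses. *)
Lemma homology_basis (h : 'rV['F_p]_r) :
  h = \sum_i letter_class (i, false) *+ h 0 i.
Proof.
apply/rowP => j; rewrite summxE (bigD1 j) //= big1 => [|i ij].
  by rewrite addr0 mulmxnE letter_classE eqxx natr_Zp.
by rewrite mulmxnE letter_classE (negPf ij) mul0rn.
Qed.

(* A state records the last letter of a reduced word and its homology class. *)
Local Notation state := (letter r * 'rV['F_p]_r)%type.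

Definition step (s t : state) : bool :=
  adjacent s.1 t.1 && (t.2 == s.2 + letter_class t.1).

Lemma card_step_out s : #|step s| = #|letter r|.-1.
Proof.
rewrite -(cardC1 (inv_letter s.1)).
rewrite -(@fintype.card_image _ _ (fun x => (x, s.2 + letter_class x) : state)) => [|x y []] //.
apply: eq_card => -[x g]; apply/andP/fintype.imageP => /= [[sx /eqP->]|[y sy [-> ->]]].
  by exists x.
by split.
Qed.

(** A predecessor is determined by its letter, since its class must be [t.2 - letter_class t.1]. *)
Lemma card_step_in t : #|step^~ t| = #|letter r|.-1.
Proof.
rewrite -(cardC1 (inv_letter t.1)).
rewrite -(@fintype.card_image _ _ (fun x => (x, t.2 - letter_class t.1) : state)) => [|x y []] //.
apply: eq_card => -[x g]; apply/andP/fintype.imageP => /= [[xt /eqP gE]|[y ty [-> ->]]].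
  by exists x; rewrite ?gE ?addrK // [_ \in _]adjacentC.
by rewrite subrK eqxx adjacentC.
Qed.

(** A walk is encoded by the word of letters it enters; the starting letter [x] is not part of that
    word and only restricts its first letter. *)
Lemma nwalks_step_words n x y g k :
  nwalks step n (x, g) (y, k) =
  #|[pred w : n.-tuple (letter r) | [&& path adjacent x w, last x w == y
      & g + homology_class p w == k]]|.
Proof.
elim: n x g => [|n IH] x g.
  rewrite (@eq_card _ _ [pred w : 0.-tuple (letter r) | (x, g) == (y, k)]) /=.
    case: ((x, g) == (y, k)); last by rewrite eq_card0.
    by rewrite [RHS]eq_cardT // -cardT card_tuple.
  by move=> w; rewrite !inE tuple0 /= homology_class_nil addr0 xpair_eqE.
rewrite card_tuple_cons /= big_mkcond /=.
transitivity (\sum_z \sum_l if step (x, g) (z, l) then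
   nwalks step n (z, l) (y, k) else 0)%N.
  by rewrite pair_bigA; apply: eq_bigr => -[].
(* The letter [z] forces the class of the next state, so a single term survives. *)
apply: eq_bigr => z _; rewrite (bigD1 (g + letter_class z)) //= big1 ?addn0.
  rewrite /step /= eqxx andbT; case: ifP => xz; last first.
    by rewrite eq_card0 // => w; rewrite !inE /= xz.
  rewrite IH; apply: eq_card => w.
  by rewrite !inE /= homology_class_cons addrA.
by move=> l /negPf gl; rewrite /step /= gl andbF.
Qed.

(** Starting the walk at the last letter of the word turns the cyclic condition into the condition
    on its first step. The empty word has no last letter, hence [0 < n]. *)
Lemma W_nwalks n (h : 'rV['F_p]_r) : (0 < n)%N ->
  W n h = (\sum_x nwalks step n (x, 0%R) (x, h))%N.
Proof.
case: n => // n _; rewrite /W cardsE -sum1_card.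
(* The word is nonempty, so the default [thead w] does not affect its last letter. *)
rewrite (partition_big (fun w : n.+1.-tuple _ => last (thead w) w) predT) //.
apply: eq_bigr => x _; rewrite nwalks_step_words -sum1_card; apply: eq_bigl => w.
rewrite [RHS]inE [w \in _]unfold_in /= add0r /cyclically_reduced (cycle_path (thead w)).
have -> : last x w = last (thead w) w by case/tupleP: w.
by rewrite andbAC andbA; case: eqP => [->|]; rewrite ?andbF ?andbT.
Qed.

(** * Loops, connectedness and primitivity of the walk *)

Definition reach n (s t : state) : Prop := (0 < nwalks step n s t)%N.

Lemma reach_trans m n s t u : reach m s t -> reach n t u -> reach (m + n) s u.
Proof.
move=> st tu; rewrite /reach nwalksD (bigD1 t) //=.
by rewrite ltn_addr // muln_gt0 [(0 < _)%N]st.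
Qed.

Lemma reach_word x g (w : seq (letter r)) : path adjacent x w ->
  reach (size w) (x, g) (last x w, g + homology_class p w).
Proof.
move=> xw; rewrite /reach nwalks_step_words; apply/card_gt0P.
by exists (in_tuple w); rewrite inE /= xw !eqxx.
Qed.

Hypotheses (p_prime : prime p) (p_odd : odd p) (r_ge2 : (2 <= r)%N).

Lemma letter_class_mulrp x : letter_class x *+ p = 0.
Proof.
by apply/rowP => i; rewrite mulmxnE mxE mulrn_pchar // ?pchar_Fp // mxE.
Qed.

Lemma letter_class_mulrp1 x : letter_class x *+ p.-1 = - letter_class x.
Proof.
apply/eqP; rewrite -addr_eq0 -mulrSr prednK ?prime_gt0 //.
by rewrite letter_class_mulrp.
Qed.

Lemma other_index (i : 'I_r) : exists j : 'I_r, j != i.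
Proof.
have [i0|i0] := eqVneq (val i) 0%N.
  by exists (Ordinal r_ge2); apply/eqP => /(congr1 val) /=; rewrite i0.
by exists (Ordinal (ltnW r_ge2)); rewrite eq_sym.
Qed.

(** The loop reads x^p, whose class vanishes mod p. *)
Lemma reach_loop_p s : reach p s s.
Proof.
case: s => x g; have := @reach_word x g _ (path_adjacent_nseq p x).
by rewrite size_nseq last_nseq homology_class_nseq letter_class_mulrp addr0.
Qed.

(* The loop reads b x b^-1 x^(p-1), for a generator b other than that of x. *)
Lemma reach_loop_p2 s : reach p.+2 s s.
Proof.
case: s => x g; have [j jx] := other_index x.1.
pose b : letter r := (j, false).
(* As p >= 2, the block x^(p-1) is nonempty and the word does end in [x]. *)
have p1 : p.-1 = p.-2.+1 by case: p p_prime => [|[]].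
have lastE : last (inv_letter b) (nseq p.-1 x) = x by rewrite p1 /= last_nseq.
have pathE : path adjacent (inv_letter b) (nseq p.-1 x).
  by rewrite p1 /= path_adjacent_nseq adjacent_neq_index.
have := @reach_word x g ([:: b; x; inv_letter b] ++ nseq p.-1 x).
rewrite /= size_nseq lastE pathE prednK ?prime_gt0 //.
rewrite !homology_class_cons homology_class_nseq letter_class_mulrp1.
rewrite letter_class_inv -opprD [letter_class b + _]addrA subrr addr0.
by apply; rewrite !adjacent_neq_index // eq_sym.
Qed.

(* As [p] is odd, [p] and [p.+2] are coprime, and n = p a + (p + 2) b has a
   solution with b < p. *)
Lemma reach_loop n s : (p * p.+2 <= n)%N -> reach n s s.
Proof.
move=> n_large.
have reachM k m : reach m s s -> reach (k * m) s s.
  move=> rm; elim: k => [|k IH]; first by rewrite /reach /= eqxx.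
  by rewrite mulSn; apply: reach_trans rm IH.
(* Modulo the odd number [p], [p.+1./2] is the inverse of [p.+2], so [b * p.+2] is congruent to
   [n]. *)
pose b := ((n * p.+1./2) %% p)%N.
have b_lt : (b < p)%N by rewrite ltn_mod prime_gt0.
have bn : (b * p.+2 <= n)%N.
  by apply: leq_trans n_large; rewrite leq_mul2r ltnW.
have : (p %| n - b * p.+2)%N.
  rewrite -eqn_mod_dvd // modnMml -mulnA.
  have -> : (p.+1./2 * p.+2 = 1 + p * (p.+1./2).+1)%N.
    have := odd_double_half p.+1; rewrite /= p_odd /= add0n -muln2.
    by lia.
  by rewrite mulnDr muln1 mulnCA [(p * _)%N]mulnC addnC modnMDl.
case/dvdnP => a nE; rewrite -(subnK bn) nE.
by apply: reach_trans; apply: reachM; [apply: reach_loop_p | apply: reach_loop_p2].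
Qed.

Definition reachable s t : Prop := exists n, reach n s t.

Lemma reachable_trans s t u : reachable s t -> reachable t u -> reachable s u.
Proof. by move=> [m st] [n tu]; exists (m + n)%N; apply: reach_trans st tu. Qed.

Lemma reachable_word x g (w : seq (letter r)) : path adjacent x w ->
  reachable (x, g) (last x w, g + homology_class p w).
Proof. by move=> /(reach_word g); exists (size w). Qed.

(** The word y x^p adds the class of [y] and returns to [x]; when y = x^-1 it is not allowed, and
    x^(p-1) replaces it. *)
Lemma reachable_add_letter x g y : reachable (x, g) (x, g + letter_class y).
Proof.
have [yx|xy] := eqVneq y (inv_letter x).
  have := reachable_word g (path_adjacent_nseq p.-1 x).
  by rewrite last_nseq homology_class_nseq letter_class_mulrp1 yx letter_class_inv.
have p1 : p = p.-1.+1 by rewrite prednK ?prime_gt0.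
have lastE : last y (nseq p x) = x by rewrite p1 /= last_nseq.
have pathE : path adjacent y (nseq p x).
  by rewrite p1 /= path_adjacent_nseq adjacentC [adjacent _ _]xy.
have := @reachable_word x g (y :: nseq p x).
rewrite /= lastE pathE homology_class_cons homology_class_nseq letter_class_mulrp.
by rewrite addr0 [adjacent _ _]xy; apply.
Qed.

Lemma reachable_add x g h : reachable (x, g) (x, g + h).
Proof.
rewrite (homology_basis h); elim/big_rec: _ g => [|i k _ IH] g.
  by rewrite addr0; exists 0%N; rewrite /reach /= eqxx.
rewrite addrA; apply: reachable_trans (IH _).
elim: (nat_of_ord _) g => [|n IHn] g.
  by rewrite mulr0n addr0; exists 0%N; rewrite /reach /= eqxx.
by rewrite mulrS addrA; apply: reachable_trans (IHn _); apply: reachable_add_letter.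
Qed.

(** Only y = x^-1 cannot follow [x] directly; a generator of another index is then inserted between
    them. *)
Lemma reachable_letter x y g : exists k, reachable (x, g) (y, k).
Proof.
have [yx|xy] := boolP (adjacent x y).
  by exists (g + homology_class p [:: y]); apply: (@reachable_word x g [:: y]); rewrite /= yx.
have [j jx] := other_index x.1; pose b : letter r := (j, false).
exists (g + homology_class p [:: b; y]).
apply: (@reachable_word x g [:: b; y]).
have xb : adjacent x b by rewrite adjacent_neq_index // eq_sym.
have /eqP-> : y == inv_letter x by apply: negbNE.
by rewrite /= xb adjacent_neq_index.
Qed.

Lemma reachable_all s t : reachable s t.
Proof.
case: s t => x g [y h]; have [k xy] := reachable_letter x y g.
(* The letter [y] is reached first, and the class is then corrected by h - k. *)
by apply: reachable_trans xy _; rewrite -[h](subrK k) addrC; apply: reachable_add.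
Qed.

(** A fixed walk from [s] to [t], preceded by a loop at [s], attains every sufficiently large
    length. *)
Lemma step_primitive :
  exists2 m, (0 < m)%N & forall s t, (0 < nwalks step m s t)%N.
Proof.
apply: primitive_of_long_walks => s t; have [k st] := reachable_all s t.
exists (p * p.+2 + k)%N => n n_large.
have k_le : (k <= n)%N by apply: leq_trans n_large; apply: leq_addl.
rewrite -(subnK k_le); apply: reach_trans st; apply: reach_loop.
by rewrite -(leq_add2r k) subnK.
Qed.

End LetterHomology.

(* For r <= 1, and for p = 2 because of parity, W n h1 vanishes for infinitely
   many n and the ratio has no limit: hence r >= 2 and p odd. *)
Theorem theorem6p1 (R : realType) (p r : nat) (h1 h2 : 'rV['F_p]_r) :
  prime p -> odd p -> (2 <= r)%N ->
  (fun n : nat => (W n h2)%:R / (W n h1)%:R : R) @ \oo --> (1 : R).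
Proof.
move=> p_prime p_odd r_ge2.
have [m m_gt0 m_prim] := step_primitive p_prime p_odd r_ge2.
set d := #|letter r|.-1.
have letters : (1 < #|letter r|)%N.
  rewrite card_prod card_ord card_bool; lia.
have d_gt0 : (0 < d)%N by rewrite /d; lia.
(* Every choice of last letter contributes the same limit, whatever the class [h]. *)
pose c : R := \sum_(x : letter r) #|{: letter r * 'rV['F_p]_r}|%:R^-1.
have c_neq0 : c != 0.
  rewrite /c sumr_const mulrn_eq0 invr_eq0 pnatr_eq0 negb_or -!lt0n (ltnW letters) /=.
  by rewrite card_prod muln_gt0 (ltnW letters); apply/card_gt0P; exists 0.
have W_cvg (h : 'rV['F_p]_r) : (W n h)%:R / d%:R ^+ n @[n --> \oo] --> c.
  have sum_cvg : (\sum_x (nwalks (@step p r) n (x, 0%R) (x, h))%:R / d%:R ^+ n : R)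
      @[n --> \oo] --> c.
    apply: cvg_big => [|x _]; first exact: add_continuous.
    exact: (nwalks_equidistribution (@card_step_out p r) (@card_step_in p r)
      d_gt0 m_gt0 m_prim).
  (* The count by walks is valid only for n > 0, so the two sequences agree eventually. *)
  apply: cvg_trans sum_cvg; apply: near_eq_cvg; near=> n.
  rewrite W_nwalks ?natr_sum ?mulr_suml //.
  by near: n; apply: nbhs_infty_gt.
have ratioE : (fun n => (W n h2)%:R / (W n h1)%:R : R) =
    (fun n => ((W n h2)%:R / d%:R ^+ n) * ((W n h1)%:R / d%:R ^+ n)^-1).
  (* The identity holds for every [n], even where [W n h1] vanishes, since the inverse of 0 is 0. *)
  apply/funext => n; rewrite invfM invrK mulrACA mulVf ?mulr1 //.
  by rewrite expf_neq0 // pnatr_eq0 -lt0n.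
rewrite ratioE -[X in _ --> X](divff c_neq0).
exact: (cvgM (W_cvg h2) (cvgV c_neq0 (W_cvg h1))).
Unshelve. all: by end_near.
Qed.
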